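(* Let $\alpha,\beta\ge 1$ be real numbers and let $\lambda(\alpha,\beta)$ be the Lyapunov exponent of the random product $M_N$ of the two shear matrices $A,B$ (as defined in the context). For integers $a,b\ge1$ put $\mathcal{C}_{a\alpha b\beta}=(a\alpha+b\beta)^2+(a\alpha b\beta)^2$ and $$\phi_1(a,b,\alpha,\beta)=1+\tfrac{\alpha}{1+\alpha}\left(a+b\beta+a\alpha b\beta\right),$$ $$\phi_2(a,b,\alpha,\beta)=\min\left\{\left((1+a\alpha b\beta)^2+b^2\beta^2\right)^{1/2},\ \left(\tfrac{1}{1+\alpha^2}\left(\alpha^2(1+a+a\alpha b\beta)^2+(1+\alpha b\beta)^2\right)\right)^{1/2}\right\},$$ $$\phi_\infty(a,b,\alpha,\beta)=1+a\alpha b\beta,$$ $$\psi_1(a,b,\alpha,\beta)=1+b\beta+a\alpha b\beta,$$ $$\psi_2(a,b,\alpha,\beta)=\left(\tfrac12\left(2+\mathcal{C}_{a\alpha b\beta}+\sqrt{\mathcal{C}_{a\alpha b\beta}(\mathcal{C}_{a\alpha b\beta}+4)}\right)\right)^{1/2},$$ $$\psi_\infty(a,b,\alpha,\beta)=1+a+a\alpha b\beta.$$ For $k\in\{1,2,\infty\}$ let $$\mathcal{L}_k(\alpha,\beta)=\sum_{a,b=1}^\infty 2^{-a-b}\log\phi_k(a,b,\alpha,\beta),\qquad \mathcal{U}_k(\alpha,\beta)=\sum_{a,b=1}^\infty 2^{-a-b}\log\psi_k(a,b,\alpha,\beta).$$ Then $$\max_{k\in\{1,2,\infty\}}\mathcal{L}_k(\alpha,\beta)\le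 4\lambda(\alpha,\beta)\le\min_{k\in\{1,2,\infty\}}\mathcal{U}_k(\alpha,\beta).$$
   Context: For real $\alpha,\beta$ let $A=\begin{pmatrix}1&0\\ \alpha&1\end{pmatrix}$ and $B=\begin{pmatrix}1&\beta\\0&1\end{pmatrix}$. Let $M_N=\prod_{k=1}^N A_{i_k}$ be the random product in which the $N$ factors are i.i.d., each equal to $A_1=A$ or $A_2=B$ with probability $1/2$. The Lyapunov exponent is $\lambda(\alpha,\beta)=\lim_{N\to\infty}\frac1N\,\mathbb{E}\log\|M_N\|$ (independent of the matrix norm), equivalently $\lim_{N\to\infty}\frac1N\,\mathbb{E}\log\|M_NX_0\|$ for an arbitrary nonzero vector $X_0\in\mathbb{R}^2$ and any vector norm. The logarithm is natural. *)

(* Defs.v *)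
From HB Require Import structures.
From mathcomp Require Import all_boot all_order all_algebra.
From mathcomp Require Import all_classical all_reals all_analysis.

Set Implicit Arguments.
Unset Strict Implicit.
Unset Printing Implicit Defensive.

Import Order.TTheory GRing.Theory Num.Theory.
Import numFieldNormedType.Exports.

Local Open Scope classical_set_scope.
Local Open Scope ring_scope.

Definition shearA (R : realType) (alpha : R) : 'M[R]_2 :=
  \matrix_(i, j) (if i == j then 1 else if i == ord_max then alpha else 0).

Definition shearB (R : realType) (beta : R) : 'M[R]_2 :=
  \matrix_(i, j) (if i == j then 1 else if i == ord0 then beta else 0).

(* A norm on the vector space of 2 x 2 matrices; submultiplicativity is not
   required. *)
Definition matrix_norm (R : realType) (nrm : 'M[R]_2 -> R) : Prop :=
  [/\ forall M, nrm M = 0 -> M = 0,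
      forall (c : R) M, nrm (c *: M) = `|c| * nrm M &
      forall M N, nrm (M + N) <= nrm M + nrm N].

Definition mutually_independent d (T : measurableType d) d'
    (T' : measurableType d') (R : realType) (P : probability T R)
    (X : nat -> {RV P >-> T'}) : Prop :=
  forall (J : seq nat) (S : nat -> set T'),
    uniq J -> (forall j, measurable (S j)) ->
    P (\bigcap_(j in [set` J]) X j @^-1` S j) =
    (\prod_(j <- J) P (X j @^-1` S j))%E.

Definition iid_fair_coins d (T : measurableType d) (R : realType)
    (P : probability T R) (X : nat -> {RV P >-> bool}) : Prop :=
  mutually_independent X /\
  forall k (c : bool), P (X k @^-1` [set c]) = (2^-1)%:E.

(* M_N is the product of the factors 0, ..., N - 1 from left to right; the
   value true of the coin selects A, the value false selects B. *)
Definition random_product (R : realType) (T : Type) (alpha beta : R)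
    (X : nat -> T -> bool) (N : nat) (w : T) : 'M[R]_2 :=
  \prod_(k < N) (if X k w then shearA alpha else shearB beta).

Definition lyapunov_exponent d (T : measurableType d) (R : realType)
    (P : probability T R) (X : nat -> {RV P >-> bool})
    (nrm : 'M[R]_2 -> R) (alpha beta : R) : \bar R :=
  limn (fun N : nat => (N%:R^-1)%:E *
    'E_P[fun w => ln (nrm (random_product alpha beta X N w))])%E.

Section bounds.
Context {R : realType}.
Implicit Types (a b : nat) (alpha beta : R).

(* A^a B^b has rows (1, b beta) and (a alpha, 1 + a alpha b beta), and 2 + Cab is
   its squared Frobenius norm. *)
Definition Cab alpha beta a b : R :=
  (a%:R * alpha + b%:R * beta) ^+ 2 +
  (a%:R * alpha * b%:R * beta) ^+ 2.

Definition phi1 alpha beta a b : R :=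
  1 + alpha / (1 + alpha) *
      (a%:R + b%:R * beta + a%:R * alpha * b%:R * beta).

Definition phi2 alpha beta a b : R :=
  Num.min
    (Num.sqrt ((1 + a%:R * alpha * b%:R * beta) ^+ 2 + b%:R ^+ 2 * beta ^+ 2))
    (Num.sqrt ((1 + alpha ^+ 2)^-1 *
       (alpha ^+ 2 * (1 + a%:R + a%:R * alpha * b%:R * beta) ^+ 2 +
        (1 + alpha * b%:R * beta) ^+ 2))).

Definition phioo alpha beta a b : R := 1 + a%:R * alpha * b%:R * beta.

Definition psi1 alpha beta a b : R :=
  1 + b%:R * beta + a%:R * alpha * b%:R * beta.

Definition psi2 alpha beta a b : R :=
  Num.sqrt (2^-1 * (2 + Cab alpha beta a b +
    Num.sqrt (Cab alpha beta a b * (Cab alpha beta a b + 4)))).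

Definition psioo alpha beta a b : R :=
  1 + a%:R + a%:R * alpha * b%:R * beta.

Definition geometric_log_sum (f : nat -> nat -> R) : \bar R :=
  (\sum_(1 <= a <oo) \sum_(1 <= b <oo) (2 ^- (a + b) * ln (f a b))%:E)%E.

End bounds.

(* Main.v *)
(** A word with N letters almost factors into blocks A^a B^b; a given block
    (a, b), delimited as B A^a B^b A, occurs in about N 2^(-a-b-2) places of a
    random word, so by linearity of expectation the sum of log f(a, b) over the
    blocks has mean about N/4 sum_(a,b) 2^(-a-b) log f(a, b).  Every block acts
    on a vector of the cone y >= alpha x, into which A maps the quadrant, and
    stretches it by a factor between phi_k and psi_k in the k-norm; incomplete
    blocks at the two ends contribute O(1) on average.  Dividing by N compares
    both series with 4 lambda, where the limit exists by Fekete's lemma. *)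

Require Import Defs.
From HB Require Import structures.
From mathcomp Require Import all_boot all_order all_algebra.
From mathcomp Require Import all_classical all_reals all_analysis.
From mathcomp Require Import ring lra zify.

Set Implicit Arguments.
Unset Strict Implicit.
Unset Printing Implicit Defensive.

Import Order.TTheory GRing.Theory Num.Theory.
Import numFieldNormedType.Exports.

Local Open Scope classical_set_scope.
Local Open Scope ring_scope.

(** The bounds come from the edges (0, 1) and (1, alpha) of the cone: [phi1] and [psioo] are the
    stretch of (1, alpha), [psi1] and [phioo] that of (0, 1), [phi2] is the smaller of the two, and
    [psi2] is the operator norm of the block. All cases share one argument, made for a functional
    [Nm] that is monotone on the quadrant and within a factor 2 of x + y. The orbit starts at (1,
    1), outside the cone when alpha > 1, but componentwise between (0, 1) and (1, alpha), which
    costs a constant. A block cut by the end of the word is harmless for the lower bound, since log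
    phi >= 0; the upper bound uses that psi increases in a and b, so that a cut block is worth no
    more than a completed one. Submultiplicativity is not assumed of [nrm], so Fekete's lemma is
    applied to the sum of the entries and the limit is transferred by equivalence of norms. *)

(** * Averages over binary words of fixed length *)

Section word_average.
Context {R : realType}.
Implicit Types (F G : seq bool -> R) (w : seq bool).

(** Recursion on the first letter turns conditioning on that letter into unfolding;
    [expectation_coins] makes the link with the probability space. *)
Fixpoint avg N F : R :=
  if N is n.+1 then
    (avg n (fun w => F (true :: w)) + avg n (fun w => F (false :: w))) / 2
  else F [::].

Lemma avgS N F :
  avg N.+1 F =
  (avg N (fun w => F (true :: w)) + avg N (fun w => F (false :: w))) / 2.
Proof. by []. Qed.

Lemma ler_avg N F G : (forall w, F w <= G w) -> avg N F <= avg N G.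
Proof.
elim: N F G => [|N IH] F G FG /=; first exact: FG.
by rewrite ler_pM2r// lerD// IH.
Qed.

Lemma avg_cst N (c : R) : avg N (fun=> c) = c.
Proof. by elim: N => //= N ->; lra. Qed.

Lemma avgD N F G : avg N (fun w => F w + G w) = avg N F + avg N G.
Proof. by elim: N F G => //= N IH F G; rewrite !IH; lra. Qed.

Lemma avgZ N (c : R) F : avg N (fun w => c * F w) = c * avg N F.
Proof. by elim: N F => //= N IH F; rewrite !IH; lra. Qed.

Lemma avg_ge0 N F : (forall w, 0 <= F w) -> 0 <= avg N F.
Proof. by move=> F0; rewrite -(avg_cst N 0) ler_avg. Qed.

Lemma avg_cat m n F :
  avg (m + n) F = avg m (fun u => avg n (fun v => F (u ++ v))).
Proof. by elim: m F => //= m IH F; rewrite !IH. Qed.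

Fixpoint words N : seq (seq bool) :=
  if N is n.+1 then map (cons true) (words n) ++ map (cons false) (words n)
  else [:: [::]].

Lemma mem_words N w : (w \in words N) = (size w == N).
Proof.
elim: N w => [|N IH] [|c w]; rewrite ?inE// mem_cat.
  by apply/negbTE; rewrite negb_or; apply/andP; split; apply/mapP => -[].
rewrite /= eqSS -IH.
have cons_inj b : injective (cons b : seq bool -> _) by move=> u v [].
have cons_mem b b' : (b :: w \in map (cons b') (words N)) =
    (b == b') && (w \in words N).
  have [<-|bb'] := eqVneq b b'; first by rewrite (mem_map (@cons_inj b)).
  by apply/mapP => -[u _ [e _]]; rewrite e eqxx in bb'.
by rewrite !cons_mem; case: c => /=; rewrite ?orbF.
Qed.

Lemma uniq_words N : uniq (words N).
Proof.
elim: N => //= N IH; rewrite cat_uniq !map_inj_uniq ?IH/= ?andbT.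
- by apply/hasPn => _ /mapP[u _ ->]; apply/mapP => -[].
- by move=> u v [].
- by move=> u v [].
Qed.

Lemma avg_words N F : avg N F = \sum_(t <- words N) 2^-1 ^+ N * F t.
Proof.
elim: N F => [|N IH] F /=; first by rewrite big_seq1 expr0 mul1r.
rewrite big_cat/= !big_map !IH -!mulr_sumr exprS; lra.
Qed.

End word_average.

(** * Subadditive sequences *)

Section fekete.
Context {R : realType}.

(** The limit is the infimum of v m / m over m > 0, finite because v is nonnegative. Near an almost
    optimal m, Euclidean division n = q m + r gives v n <= q v m + v r. *)
Lemma fekete (v : nat -> R) :
  (forall n, 0 <= v n) -> (forall m n, v (m + n)%N <= v m + v n) ->
  cvgn (fun n => n%:R^-1 * v n).
Proof.
move=> v0 vD; pose S := [set m.+1%:R^-1 * v m.+1 | m in [set: nat]].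
have hS : has_inf S.
  split; first by exists (1%:R^-1 * v 1%N); exists 0%N.
  by exists 0 => _ [m _ <-]; rewrite mulr_ge0.
have vM q m r : v (q * m + r)%N <= q%:R * v m + v r.
  elim: q => [|q IH]; first by rewrite mul0n mul0r add0r.
  by rewrite mulSn -addnA -natr1 mulrDl mul1r (le_trans (vD _ _))//; lra.
have v1 n : v n <= n%:R * v 1%N + v 0%N by rewrite -[n in v n]muln1 -[X in v X]addn0.
apply/cvg_ex; exists (inf S); apply/cvgrPdist_le => e e0.
have [_ [m _ <-] mlt] := inf_adherent (divr_gt0 e0 (ltr0Sn _ 1)) hS.
(* Bounds v r for all remainders r at once; n >= 2 c / e then absorbs it. *)
set c := m.+1%:R * v 1%N + v 0%N.
have c0 : 0 <= c by rewrite addr_ge0 ?mulr_ge0.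
near=> n.
have n0 : (0 < n)%N by near: n; exact: nbhs_infty_gt.
have n0R : 0 < n%:R :> R by rewrite ltr0n.
have lo : inf S <= n%:R^-1 * v n.
  apply: ge_inf; first by case: hS.
  by exists n.-1 => //; rewrite prednK.
have nc : 2 * c / e <= n%:R by near: n; exact: nbhs_infty_ger.
have q0 : (n %/ m.+1)%:R * m.+1%:R <= n%:R :> R by rewrite -natrM ler_nat leq_trunc_div.
have vn : v n <= (n %/ m.+1)%:R * v m.+1 + c.
  rewrite {1}(divn_eq n m.+1) (le_trans (vM _ _ _))// lerD2l (le_trans (v1 _))//.
  by rewrite lerD2r ler_wpM2r// ler_nat ltnW// ltn_mod.
have hm : v m.+1 <= (inf S + e / 2) * m.+1%:R.
  by rewrite -ler_pdivrMr// mulrC ltW.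
have S0 : 0 <= inf S by apply: lb_le_inf (proj1 hS) _ => _ [k _ <-]; rewrite mulr_ge0.
rewrite ler0_norm ?subr_le0// opprB lerBlDr mulrC ler_pdivrMr//.
apply: (le_trans vn).
have : c <= e / 2 * n%:R by move: nc; rewrite ler_pdivrMr//; lra.
have h1 : (n %/ m.+1)%:R * v m.+1 <= (n %/ m.+1)%:R * ((inf S + e / 2) * m.+1%:R).
  by rewrite ler_wpM2l.
have h2 : (inf S + e / 2) * ((n %/ m.+1)%:R * m.+1%:R) <= (inf S + e / 2) * n%:R.
  by rewrite ler_wpM2l// addr_ge0// ltW// divr_gt0.
by move: h1 h2; rewrite mulrCA; lra.
Unshelve. all: by end_near. Qed.

End fekete.

(** * Mean gain of the blocks of a word *)

Section block_gain.
Context {R : realType}.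
Variable f : nat -> nat -> R.

(* In words, [true] stands for A and [false] for B.  [runA a w] is the value
   [f a' b'] of the block A^a' B^b' at the head of A^a w, and [runB (f a) b w]
   that of the block at the head of A^a B^b w.  The end of the word closes the
   current block, as if BA followed when the block is still a run of A. *)
Fixpoint runB (h : nat -> R) b w : R :=
  if w is false :: w' then runB h b.+1 w' else h b.

Fixpoint runA a w : R :=
  match w with
  | [::] => f a 1
  | true :: w' => runA a.+1 w'
  | false :: w' => runB (f a) 1 w'
  end.

Definition head_block w : R := if w is true :: w' then runA 1 w' else 0.

(* The sum of [f a b] over the blocks of [w] that are preceded by B. *)
Fixpoint gain w : R :=
  if w is c :: w' then gain w' + (if c then 0 else head_block w') else 0.

(** A new first letter B makes the head block of the rest count, while A adds nothing. Together with
    [avg_head_blockS], the mean gain grows by a quarter of the mean of [runA 1] per letter, whence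
    the factor 4 of the theorem. *)
Lemma avg_gainS N : avg N.+1 gain = avg N gain + avg N head_block / 2.
Proof. by rewrite avgS /= !avgD avg_cst; lra. Qed.

Lemma avg_head_blockS N : avg N.+1 head_block = avg N (runA 1) / 2.
Proof. by rewrite avgS /= avg_cst; lra. Qed.

Lemma avg_runBS (h : nat -> R) b N :
  avg N.+1 (runB h b) = (h b + avg N (runB h b.+1)) / 2.
Proof. by rewrite avgS/= avg_cst. Qed.

Lemma avg_runAS a N :
  avg N.+1 (runA a) = (avg N (runA a.+1) + avg N (runB (f a) 1)) / 2.
Proof. by []. Qed.

(** The term [|u|] pays for the first letter, whose increment is 0 even if u < 0. *)
Lemma avg_gain_le (u : R) N : (forall n, avg n (runA 1) <= u) ->
  avg N gain <= N%:R * (u / 4) + `|u|.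
Proof.
move=> hu; elim: N => [|N IH] /=; first by rewrite mul0r add0r.
have := avg_gainS N; rewrite [avg N.+1 _]/= => ->.
suff : avg N head_block <= if N is 0 then 0 else u / 2.
  case: N IH => [|N] + h.
    have {}h : avg 0 head_block <= 0 := h; have -> : avg 0 gain = 0 by [].
    by have := ler_norm u; have := ler_norm (-u); rewrite normrN mul1r; lra.
  have {}h : avg N.+1 head_block <= u / 2 := h.
  by rewrite -[N.+2%:R]natr1; lra.
by case: N {IH} => [//|N]; rewrite avg_head_blockS; have := hu N; lra.
Qed.

Hypothesis f_ge0 : forall a b, (0 < a)%N -> (0 < b)%N -> 0 <= f a b.

Lemma runB_ge0 a b w : (0 < a)%N -> (0 < b)%N -> 0 <= runB (f a) b w.
Proof.
by elim: w b => [|[] w IH] b a0 b0 /=; [exact: f_ge0|exact: f_ge0|exact: IH].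
Qed.

Lemma runA_ge0 a w : (0 < a)%N -> 0 <= runA a w.
Proof.
elim: w a => [|[] w IH] a a0 /=; [exact: f_ge0|exact: IH|exact: runB_ge0].
Qed.

Lemma head_block_ge0 w : 0 <= head_block w.
Proof. by case: w => [//|[] w//]; exact: runA_ge0. Qed.

Lemma gain_ge0 w : 0 <= gain w.
Proof.
by elim: w => //= c w IH; rewrite addr_ge0//; case: c => //; exact: head_block_ge0.
Qed.

Lemma avg_gain_ge (s : R) K n : (forall N, (K <= N)%N -> s <= avg N (runA 1)) ->
  n%:R * (s / 4) <= avg (n + K.+1) gain.
Proof.
move=> hs; elim: n => [|n IH].
  by rewrite mul0r; apply: avg_ge0; exact: gain_ge0.
rewrite addSn avg_gainS addnS avg_head_blockS.
have := hs (n + K)%N (leq_addl _ _); move: IH; rewrite addnS -[n.+1%:R]natr1; lra.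
Qed.

(** The factor [2 * 2 ^- b] is the sum of 2^-j over j >= b: it turns the law of a run of length at
    least b into the weights 2^-j. The run cut by the end of the word contributes a nonnegative
    value, which is dropped. *)
Lemma avg_runB_ge a b N : (0 < a)%N -> (0 < b)%N ->
  \sum_(b <= j < b + N) 2 ^- j * f a j <= 2 * 2 ^- b * avg N (runB (f a) b).
Proof.
move=> a0; elim: N b => [|N IH] b b0.
  by rewrite addn0 big_geq// mulr_ge0//= f_ge0.
rewrite big_ltn ?ltnS ?leq_addr//; last by rewrite addnS ltnS leq_addr.
rewrite avg_runBS addnS -addSn; have := IH b.+1 isT.
rewrite exprS invfM; lra.
Qed.

(** The condition on N leaves at least m letters for the run of B in each of the n rows. *)
Lemma avg_runA_ge a n m N : (0 < a)%N -> (n + m <= N)%N ->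
  \sum_(a <= i < a + n) 2 ^- i * (\sum_(1 <= j < 1 + m) 2 ^- j * f i j)
    <= 2 * 2 ^- a * avg N (runA a).
Proof.
elim: n a N => [|n IH] a N a0 nmN.
  by rewrite addn0 big_geq// mulr_ge0 ?avg_ge0// => w; exact: runA_ge0.
case: N nmN => // N; rewrite addSn ltnS => nmN.
rewrite big_ltn; last by rewrite addnS ltnS leq_addr.
rewrite avg_runAS addnS -addSn.
have := IH a.+1 N isT nmN.
have h : \sum_(1 <= j < 1 + m) 2 ^- j * f a j <= avg N (runB (f a) 1).
  apply: (@le_trans _ _ (\sum_(1 <= j < 1 + N) 2 ^- j * f a j)).
    rewrite (@big_cat_nat _ _ _ (1 + m) 1 (1 + N))//= ?ltnS; last by lia.
    rewrite lerDl big_nat; apply: sumr_ge0 => j /andP[+ _].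
    by rewrite add1n => /(leq_ltn_trans (leq0n m)) j0; rewrite mulr_ge0// f_ge0.
  by have := avg_runB_ge N a0 (ltn0Sn 0); rewrite expr1 divff// mul1r.
have h2 : 2 ^- a * (\sum_(1 <= j < 1 + m) 2 ^- j * f a j) <= 2 ^- a * avg N (runB (f a) 1).
  by rewrite ler_wpM2l.
rewrite exprS invfM; lra.
Qed.

End block_gain.

(** * Comparison of means with the double series *)

Section block_series.
Context {R : realType}.

Lemma cvg_shift_mean (v : nat -> R) (l c : R) :
  n%:R^-1 * v n @[n --> \oo] --> l ->
  n%:R^-1 * (v n + c) @[n --> \oo] --> l.
Proof.
move=> vl; rewrite -[l]addr0.
under eq_fun do rewrite mulrDr.
apply: cvgD => //; rewrite -[0](mul0r c); apply: cvgM; last exact: cvg_cst.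
rewrite -(cvg_shiftS (fun n => n%:R^-1 : R)).
exact: cvg_harmonic.
Qed.

Lemma mean_ge (v : nat -> R) (l c s : R) K :
  n%:R^-1 * v n @[n --> \oo] --> l ->
  (forall n, n%:R * s <= v (n + K)%N + c) -> s <= l.
Proof.
move=> vl hv.
have := @cvg_shift_mean _ _ (c + K%:R * s) vl.
move=> /[dup] /cvg_lim <- //; move=> /cvgP vcvg.
apply: limr_ge => //; near=> n.
have Kn : (K < n)%N by near: n; exact: nbhs_infty_gt.
have n0 : 0 < n%:R :> R by rewrite ltr0n (leq_ltn_trans _ Kn).
rewrite mulrC ler_pdivlMr//.
have := hv (n - K)%N.
rewrite subnK; last exact: ltnW.
rewrite natrB; last exact: ltnW.
rewrite mulrBl lerBlDr -addrA mulrC.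
by [].
Unshelve. all: by end_near. Qed.

Lemma mean_le (v : nat -> R) (l c s : R) :
  n%:R^-1 * v n @[n --> \oo] --> l ->
  (forall n, v n <= n%:R * s + c) -> l <= s.
Proof.
move=> vl hv; rewrite -lerN2; apply: (@mean_ge (fun n => - v n) _ c _ 0).
  by under eq_fun do rewrite mulrN; exact: cvgN.
by move=> n; rewrite addn0; have := hv n; lra.
Qed.

Lemma geometric_tail (c : R) b : 0 <= c ->
  (\sum_(b.+1 <= j <oo) (2 ^- j * c)%:E = (2 * 2 ^- b.+1 * c)%:E)%E.
Proof.
move=> c0; rewrite -nneseries_addn; last by move=> i; rewrite lee_fin mulr_ge0.
have -> : 2 * 2 ^- b.+1 * c = c / 2 ^+ b.
  by rewrite exprS invfM mulrA divff// mul1r mulrC.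
rewrite -(cvg_lim _ (@cvg_geometric_eseries_half R c b))//.
apply: congr_lim; apply/funext => n; rewrite /eseries/=.
by apply: eq_bigr => i _; rewrite natrX mulrC.
Qed.

Variable f : nat -> nat -> R.
Hypothesis f_ge0 : forall a b, 0 <= f a b.

Let row a b : \bar R := (\sum_(b <= j <oo) (2 ^- j * f a j)%:E)%E.
Let total a : \bar R := (\sum_(a <= i <oo) (2 ^- i)%:E * row i 1)%E.

Let row_ge0 a b : (0 <= row a b)%E.
Proof. by apply: nneseries_ge0 => j _ _; rewrite lee_fin mulr_ge0. Qed.

Let row_term_ge0 a b : (0 <= (2 ^- b * f a b)%:E)%E.
Proof. by rewrite lee_fin mulr_ge0. Qed.

Let total_term_ge0 a : (0 <= (2 ^- a)%:E * row a 1)%E.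
Proof. by rewrite mule_ge0. Qed.

Let row_recl a b : row a b = ((2 ^- b * f a b)%:E + row a b.+1)%E.
Proof.
by rewrite /row (@nneseries_split _ _ b 1)// addn1 big_nat1.
Qed.

Let total_recl a : total a = ((2 ^- a)%:E * row a 1 + total a.+1)%E.
Proof.
by rewrite /total (@nneseries_split _ _ a 1)// addn1 big_nat1.
Qed.

Lemma block_sumE (g : nat -> nat -> R) : (forall a b, ln (g a b) = f a b) ->
  geometric_log_sum g = total 1.
Proof.
move=> gf; rewrite /geometric_log_sum /total.
apply: congr_lim; apply/funext => n; apply: eq_bigr => a _.
rewrite /row -nneseriesZl; last by move=> j _; exact: row_term_ge0.
apply: congr_lim; apply/funext => m; apply: eq_bigr => b _.
by rewrite gf -EFinM exprD invfM mulrA.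
Qed.

(** Rectangular partial sums suffice because the terms are nonnegative: for a finite outer range the
    inner series merge into a single one, whose partial sums are rectangles. *)
Lemma total_le (x : \bar R) :
  (forall n m, ((\sum_(1 <= i < 1 + n)
     2 ^- i * (\sum_(1 <= j < 1 + m) 2 ^- j * f i j))%:E <= x)%E) ->
  (total 1 <= x)%E.
Proof.
move=> hx; apply: lime_le; first by apply: is_cvg_nneseries => a _ _.
exists 1%N => // -[//|n] _.
have -> : (\sum_(1 <= i < n.+1) (2 ^- i)%:E * row i 1 =
    \sum_(1 <= j <oo) \sum_(1 <= i < n.+1) (2 ^- i * (2 ^- j * f i j))%:E)%E.
  rewrite nneseries_sum_nat; last by move=> i j; rewrite lee_fin !mulr_ge0.
  apply: eq_bigr => i _; rewrite /row -nneseriesZl; last first.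
    by move=> j _; exact: row_term_ge0.
  by [].
apply: lime_le.
  apply: is_cvg_nneseries => j _ _; apply: sume_ge0 => i _.
  by rewrite lee_fin !mulr_ge0.
exists 1%N => // -[//|m] _.
apply: le_trans (hx n m); rewrite exchange_big/=.
rewrite -sumEFin; apply: lee_sum => i _.
by rewrite sumEFin mulr_sumr.
Qed.

Hypothesis f_mono1 : forall a a' b, (a <= a')%N -> f a b <= f a' b.
Hypothesis f_mono2 : forall a b b', (b <= b')%N -> f a b <= f a b'.

Let row_ge a b : ((2 * 2 ^- b.+1 * f a b.+1)%:E <= row a b.+1)%E.
Proof.
rewrite -geometric_tail// /row -nneseries_addn; last first.
  by move=> i; rewrite lee_fin mulr_ge0.
rewrite -[leRHS]nneseries_addn//.
apply: lee_nneseries => i; first by rewrite lee_fin mulr_ge0.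
by rewrite lee_fin ler_wpM2l// f_mono2// leq_addl.
Qed.

(** Stopping at the end of the word replaces the final length of the run by a smaller one. As f
    increases in b, the value at the cut, times the weight of all longer runs, is at most the tail
    of the series ([row_ge]). *)
Lemma avg_runB_le a b N :
  ((2 * 2 ^- b.+1 * avg N (runB (f a) b.+1))%:E <= row a b.+1)%E.
Proof.
elim: N b => [|N IH] b; first exact: row_ge.
rewrite avg_runBS row_recl.
apply: le_trans (leeD2l _ (IH b.+1)); rewrite -EFinD lee_fin.
by rewrite [2 ^+ b.+2]exprS invfM; lra.
Qed.

Lemma avg_runA_le a N :
  ((2 * 2 ^- a.+1 * avg N (runA f a.+1))%:E <= total a.+1)%E.
Proof.
elim: N a => [|N IH] a.
  have -> : avg 0 (runA f a.+1) = f a.+1 1 by [].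
  rewrite -geometric_tail// /total -nneseries_addn; last first.
    by move=> i; rewrite lee_fin mulr_ge0.
  rewrite -[leRHS]nneseries_addn//.
  apply: lee_nneseries => i; first by rewrite lee_fin mulr_ge0.
  rewrite EFinM lee_pmul2l// ?lte_fin//.
  move=> _; apply: le_trans (row_ge _ 0); rewrite lee_fin.
  by rewrite expr1 divff// mul1r f_mono1// leq_addl.
rewrite avg_runAS total_recl.
apply: le_trans (leeD2l _ (IH a.+1)).
have h : ((2 ^- a.+1)%:E * (avg N (runB (f a.+1) 1))%:E <=
          (2 ^- a.+1)%:E * row a.+1 1)%E.
  rewrite lee_pmul2l// ?lte_fin//.
  by have := avg_runB_le a.+1 0 N; rewrite expr1 divff// mul1r.
apply: le_trans (leeD2r _ h); rewrite -EFinM -EFinD lee_fin.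
by rewrite [2 ^+ a.+2]exprS invfM; lra.
Qed.

Lemma mean_ge_block_sum (v : nat -> R) (l c : R) (g : nat -> nat -> R) :
  (forall a b, ln (g a b) = f a b) ->
  n%:R^-1 * v n @[n --> \oo] --> l ->
  (forall N, avg N (gain f) <= v N + c) ->
  (geometric_log_sum g <= 4%:E * l%:E)%E.
Proof.
move=> gf vl hv; rewrite (block_sumE gf); apply: total_le => n m.
set s := \sum_(_ <= _ < _) _.
have hs N : (n + m <= N)%N -> s <= avg N (runA f 1).
  move=> /(avg_runA_ge (fun a b _ _ => f_ge0 a b) (ltn0Sn 0)).
  by rewrite expr1 divff// mul1r.
rewrite -EFinM lee_fin.
have : s / 4 <= l.
  apply: (@mean_ge v l c _ (n + m).+1 vl) => k.
  apply: le_trans (hv _); apply: avg_gain_ge => //.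
lra.
Qed.

Lemma mean_le_block_sum (v : nat -> R) (l c : R) (g : nat -> nat -> R) :
  (forall a b, ln (g a b) = f a b) ->
  n%:R^-1 * v n @[n --> \oo] --> l ->
  (forall N, v N <= avg N (gain f) + avg N (head_block f) + c) ->
  (4%:E * l%:E <= geometric_log_sum g)%E.
Proof.
move=> gf vl hv; rewrite (block_sumE gf).
have : (0 <= total 1)%E by apply: nneseries_ge0 => i _ _; exact: total_term_ge0.
(* An infinite sum makes the bound trivial; a finite one bounds the means of [runA 1] uniformly in
   the length. *)
case E : (total 1) => [u| |//]; last by move=> _; exact: leey.
rewrite lee_fin => u0.
have hu N : avg N (runA f 1) <= u.
  have := avg_runA_le 0 N.
  by rewrite expr1 divff// mul1r E.
have hh N : avg N (head_block f) <= u.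
  case: N => [//|N]; rewrite avg_head_blockS; have := hu N; lra.
rewrite -EFinM lee_fin.
have : l <= u / 4.
  apply: (@mean_le v l (`|u| + u + c) _ vl) => N.
  apply: (le_trans (hv N)).
  by have := avg_gain_le N hu; have := hh N; lra.
lra.
Qed.

End block_series.

(** * Growth of vectors along a word *)

Section shear_action.
Context {R : realType}.
Variables alpha beta : R.
Hypothesis alpha_ge1 : 1 <= alpha.
Hypothesis beta_ge1 : 1 <= beta.

Let alpha_ge0 : 0 <= alpha. Proof. exact: le_trans alpha_ge1. Qed.
Let beta_ge0 : 0 <= beta. Proof. exact: le_trans beta_ge1. Qed.

Definition step (c : bool) (v : R * R) : R * R :=
  if c then (v.1, alpha * v.1 + v.2) else (v.1 + beta * v.2, v.2).

(** The first letter acts last, as in the matrix product. In an induction on w, letters stripped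
    from its head are thus collected in a [block] that acts after w. *)
Definition act (w : seq bool) (v : R * R) : R * R := foldr step v w.

(* The action of A^a B^b. *)
Definition block (a b : nat) (v : R * R) : R * R :=
  (v.1 + b%:R * beta * v.2, a%:R * alpha * (v.1 + b%:R * beta * v.2) + v.2).

Definition le2 (u v : R * R) := (u.1 <= v.1) /\ (u.2 <= v.2).

Lemma le2_trans u v t : le2 u v -> le2 v t -> le2 u t.
Proof. by move=> [? ?] [? ?]; split; apply: le_trans; eassumption. Qed.

Lemma block1 v : block 1 0 v = step true v.
Proof. by rewrite /block /step/= mul0r mul0r addr0 mul1r. Qed.

Lemma blockA a v : block a 0 (step true v) = block a.+1 0 v.
Proof. by rewrite /block /step/= -[a.+1%:R]natr1; congr pair; ring. Qed.

Lemma blockB0 a v : block a 0 (step false v) = block a 1 v.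
Proof. by rewrite /block /step/=; congr pair; ring. Qed.

Lemma blockB a b v : block a b (step false v) = block a b.+1 v.
Proof. by rewrite /block /step/= -[b.+1%:R]natr1; congr pair; ring. Qed.

Lemma le2_step c u v : le2 u v -> le2 (step c u) (step c v).
Proof.
move=> [uv1 uv2]; case: c; split => //=; rewrite lerD//.
  by rewrite ler_wpM2l.
by rewrite ler_wpM2l.
Qed.

Lemma le2_act w u v : le2 u v -> le2 (act w u) (act w v).
Proof. by move=> uv; elim: w => //= c w; exact: le2_step. Qed.

Lemma le2_block a b u v : le2 u v -> le2 (block a b u) (block a b v).
Proof.
move=> [uv1 uv2].
have h : u.1 + b%:R * beta * u.2 <= v.1 + b%:R * beta * v.2.
  by rewrite lerD// ler_wpM2l// mulr_ge0.
by split => //=; rewrite lerD// ler_wpM2l// mulr_ge0.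
Qed.

Lemma le2_step_id c v : le2 (0, 0) v -> le2 v (step c v).
Proof.
by move=> [/= v1 v2]; case: c; split => //=; rewrite ?lerDl ?lerDr mulr_ge0.
Qed.

Lemma le2_block_id a b v : le2 (0, 0) v -> le2 v (block a b v).
Proof.
move=> [/= v1 v2].
have h : v.1 <= v.1 + b%:R * beta * v.2 by rewrite lerDl !mulr_ge0.
split => //=; rewrite lerDr !mulr_ge0//; exact: le_trans h.
Qed.

Lemma act_ge1 w : le2 (1, 1) (act w (1, 1)).
Proof.
elim: w => [|c w IH]; first by split.
apply: (le2_trans IH); apply: le2_step_id.
by apply: le2_trans IH; split; exact: ler01.
Qed.

Lemma act_ge0 w : le2 (0, 0) (act w (1, 1)).
Proof. by apply: le2_trans (act_ge1 w); split; exact: ler01. Qed.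

Definition cone (v : R * R) := 0 <= v.1 /\ alpha * v.1 <= v.2.

Lemma cone_step v : le2 (0, 0) v -> cone (step true v).
Proof. by move=> [? ?]; split; rewrite //= lerDl. Qed.

Lemma cone_ge0 v : cone v -> le2 (0, 0) v.
Proof. by move=> [v1 v2]; split => //=; rewrite (le_trans _ v2)// mulr_ge0. Qed.

Section norm_growth.
Variable Nm : R * R -> R.
Hypothesis Nm_mono : forall u v, le2 (0, 0) u -> le2 u v -> Nm u <= Nm v.
Hypothesis Nm_le : forall v, le2 (0, 0) v -> Nm v <= v.1 + v.2.
Hypothesis Nm_ge : forall v, le2 (0, 0) v -> v.1 + v.2 <= 2 * Nm v.

Let V w := act w (1, 1).

Let Nm_ge1 v : le2 (1, 1) v -> 1 <= Nm v.
Proof.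
move=> v1; have v0 : le2 (0, 0) v by apply: le2_trans v1; split; exact: ler01.
by have := Nm_ge v0; case: v1 => /=; lra.
Qed.

Let Nm_gt0 v : le2 (1, 1) v -> 0 < Nm v.
Proof. by move=> /Nm_ge1; exact: lt_le_trans. Qed.

Let V_block_gt0 a b w : 0 < Nm (block a b (V w)).
Proof.
apply: Nm_gt0; apply: le2_trans (act_ge1 w) _.
by apply: le2_block_id; exact: act_ge0.
Qed.

Let V_gt0 w : 0 < Nm (V w).
Proof. by apply: Nm_gt0; exact: act_ge1. Qed.

Section lower.
Variable phi : nat -> nat -> R.
Hypothesis phi_ge1 : forall a b, 1 <= phi a b.
Hypothesis phi_block : forall a b v, (0 < a)%N -> (0 < b)%N -> cone v ->
  phi a b * Nm v <= Nm (block a b v).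
Let f a b := ln (phi a b).

Let phi_gt0 a b : 0 < phi a b. Proof. exact: lt_le_trans (phi_ge1 a b). Qed.

(** Completed blocks multiply the norm by at least phi; leading letters B do not decrease it. Only
    the last block, which meets (1, 1) instead of a vector of the cone, costs the constant. *)
Lemma growth_ge w :
  gain f w + head_block f w <= ln (Nm (V w)) + ln (4 * beta).
Proof.
have beta1 := beta_ge1; have V0 : le2 (0, 0) (V [::]) := act_ge0 [::].
have c0 : 0 <= ln (4 * beta) by rewrite ln_ge0//; lra.
have cone01 : cone (0, 1) by split; rewrite //= mulr0.
have Nm01 : 1 / 2 <= Nm (0, 1).
  have := Nm_ge (cone_ge0 cone01).
  rewrite /= add0r; lra.
have ln_bound a b (t : R) : 0 < t -> phi a b * (1 / 2) <= 2 * beta * t ->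
    f a b <= ln t + ln (4 * beta).
  have b4 : 0 < 4 * beta by lra.
  by move=> t0 h; rewrite -lnM ?posrE// ler_ln ?posrE ?mulr_gt0//; lra.
(* The second and third clauses are the first one for the words A^a w and A^a B^b w: the last B of
   the prefix is what makes the head block of w count in the third. *)
suff [] : [/\ gain f w + head_block f w <= ln (Nm (V w)) + ln (4 * beta),
    forall a, (0 < a)%N -> gain f w + runA f a w <=
      ln (Nm (block a 0 (V w))) + ln (4 * beta) &
    forall a b, (0 < a)%N -> (0 < b)%N ->
      gain f w + head_block f w + runB (f a) b w <=
      ln (Nm (block a b (V w))) + ln (4 * beta)] by [].
elim: w => [|[] w [IH IHA IHB]].
- split=> [|a a0|a b a0 b0] /=.
  + by rewrite add0r addr_ge0// ln_ge0// Nm_ge1//; exact: act_ge1.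
  (* A final run of A is valued as if one B followed. Supplying it costs a factor beta; one factor 2
     comes from Nm (0, 1) >= 1/2, the other from comparing [Nm] with x + y. *)
  + rewrite add0r; apply: (ln_bound _ _ _ (V_block_gt0 a 0 [::])).
    have p1 := phi_gt0 a 1; have h1 := phi_block a0 (ltn0Sn 0) cone01.
    have h2 : phi a 1 * (1 / 2) <= phi a 1 * Nm (0, 1) by rewrite ler_pM2l.
    have := Nm_le (le2_trans (cone_ge0 cone01) (le2_block_id a 1 (cone_ge0 cone01))).
    have := Nm_ge (le2_trans V0 (le2_block_id a 0 V0)).
    set t := Nm (block a 0 _); set s := Nm (block a 1 _) in h1 *.
    rewrite /block/= => h3 h4.
    have : beta * (1 + (a%:R * alpha + 1)) <= beta * (2 * t).
      by rewrite ler_wpM2l//; lra.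
    lra.
  + rewrite !add0r; apply: (ln_bound _ _ _ (V_block_gt0 a b [::])).
    have h1 : Nm (block a b (0, 1)) <= Nm (block a b (V [::])).
      apply: Nm_mono.
        exact: le2_trans (cone_ge0 cone01) (le2_block_id a b (cone_ge0 cone01)).
      by apply: le2_block; split.
    have h2 : phi a b * (1 / 2) <= phi a b * Nm (0, 1) by rewrite ler_pM2l.
    have h3 := phi_block a0 b0 cone01.
    have h4 : 1 * Nm (block a b (V [::])) <= 2 * beta * Nm (block a b (V [::])).
      by rewrite ler_pM2r//; lra.
    lra.
- split=> [|a a0|a b a0 b0] /=; rewrite addr0.
  + by have := IHA 1%N isT; rewrite block1.
  + by have := IHA a.+1 isT; rewrite -blockA.
  (* The letter A that closes the block also brings the vector into the cone, so that [phi_block]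
     applies. *)
  + apply: (@le_trans _ _ (ln (Nm (V (true :: w))) + ln (4 * beta) + f a b)).
      by rewrite lerD2r; have := IHA 1%N isT; rewrite block1.
    rewrite addrAC lerD2r addrC -lnM ?posrE//.
    rewrite ler_ln ?posrE ?mulr_gt0//; first last.
    - exact: (V_block_gt0 a b (true :: w)).
    by apply: phi_block => //; apply: cone_step; exact: act_ge0.
- split=> [|a a0|a b a0 b0] /=; rewrite ?addr0.
  + apply: (le_trans IH); rewrite lerD2r ler_ln ?posrE//; last exact: (V_gt0 (false :: w)).
    by apply: Nm_mono; [exact: act_ge0|exact: (le2_step_id false (act_ge0 w))].
  + by have := IHB a 1%N a0 isT; rewrite -blockB0.
  + by have := IHB a b.+1 a0 isT; rewrite -blockB.
Qed.

End lower.

(** Letters B before the first A belong to no block, so the upper bound pays for each of them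
    separately; their mean number is at most 1. *)
Fixpoint leading_B (w : seq bool) : R :=
  if w is false :: w' then 1 + leading_B w' else 0.

Lemma avg_leading_B N : avg N leading_B <= 1.
Proof.
elim: N => [|N IH]; first exact: ler01.
by rewrite avgS/= avgD !avg_cst; lra.
Qed.

Section upper.
Variable psi : nat -> nat -> R.
Hypothesis psi_ge1 : forall a b, 1 <= psi a b.
Hypothesis psi_block : forall a b v, (0 < a)%N -> (0 < b)%N -> cone v ->
  Nm (block a b v) <= psi a b * Nm v.
Let f a b := ln (psi a b).

Let psi_gt0 a b : 0 < psi a b. Proof. exact: lt_le_trans (psi_ge1 a b). Qed.

(** The start (1, 1) is replaced by the larger vector (1, alpha) of the cone, which gives the last
    constant. *)
Lemma growth_le w :
  ln (Nm (V w)) <= gain f w + head_block f w +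
    ln (2 * (1 + beta)) * leading_B w + ln (Nm (1, alpha)).
Proof.
set e := (1, alpha); set c := ln (2 * _); set D := ln (Nm e).
have conee : cone e by split; rewrite //= mulr1.
have e1 : le2 (1, 1) e by split.
have e_gt0 : 0 < Nm e by apply: Nm_gt0.
have V0 : le2 (0, 0) (V [::]) := act_ge0 [::].
have lnB a b (t : R) : 0 < t -> t <= psi a b * Nm e -> ln t <= f a b + D.
  move=> t0 h; rewrite -lnM ?posrE//.
  by rewrite ler_ln ?posrE// mulr_gt0.
(* Again the first clause for A^a w and A^a B^b w; these words start with A, so no term in
   [leading_B] appears. *)
suff [] : [/\ ln (Nm (V w)) <= gain f w + head_block f w + c * leading_B w + D,
    forall a, (0 < a)%N -> ln (Nm (block a 0 (V w))) <=
      gain f w + runA f a w + D &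
    forall a b, (0 < a)%N -> (0 < b)%N -> ln (Nm (block a b (V w))) <=
      gain f w + head_block f w + runB (f a) b w + D] by [].
elim: w => [|[] w [IH IHA IHB]].
- split=> [|a a0|a b a0 b0] /=.
  + by rewrite mulr0 !add0r ler_ln ?posrE//; [exact: (Nm_mono V0 e1)|exact: (V_gt0 [::])].
  + rewrite add0r; apply: lnB; first exact: (V_block_gt0 a 0 [::]).
    apply: le_trans (psi_block a0 (ltn0Sn 0) conee).
    apply: Nm_mono; first exact: le2_trans V0 (le2_block_id a 0 V0).
    apply: (@le2_trans _ (block a 0 (step false (V [::])))).
      by apply: le2_block; exact: le2_step_id.
    by rewrite blockB0; exact: le2_block.
  + rewrite !add0r; apply: lnB; first exact: (V_block_gt0 a b [::]).
    apply: le_trans (psi_block a0 b0 conee).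
    apply: Nm_mono; first exact: le2_trans V0 (le2_block_id a b V0).
    exact: le2_block.
- split=> [|a a0|a b a0 b0] /=; rewrite addr0.
  + by have := IHA 1%N isT; rewrite block1 mulr0 addr0.
  + by have := IHA a.+1 isT; rewrite -blockA.
  + apply: (@le_trans _ _ (f a b + ln (Nm (V (true :: w))))).
      rewrite -lnM ?posrE// ler_ln ?posrE ?mulr_gt0//.
      - by apply: psi_block => //; apply: cone_step; exact: act_ge0.
      - exact: (V_block_gt0 a b (true :: w)).
    by rewrite addrC [leRHS]addrAC lerD2r; have := IHA 1%N isT; rewrite block1.
- split=> [|a a0|a b a0 b0] /=; rewrite ?addr0.
  (* A single B multiplies x + y by at most 1 + beta; passing between [Nm] and x + y costs the 2. *)
  + apply: (@le_trans _ _ (c + ln (Nm (V w)))).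
      rewrite -lnM ?posrE//; last by rewrite mulr_gt0// ltr_pwDl.
      rewrite ler_ln ?posrE ?mulr_gt0// ?ltr_pwDl//; last exact: (V_gt0 (false :: w)).
      have Vw0 := act_ge0 w.
      have := Nm_le (le2_trans Vw0 (le2_step_id false Vw0)).
      have : (1 + beta) * ((V w).1 + (V w).2) <= (1 + beta) * (2 * Nm (V w)).
        by rewrite ler_wpM2l ?addr_ge0// Nm_ge.
      have : 0 <= beta * (V w).1 by rewrite mulr_ge0//; case: Vw0.
      have : 0 <= (V w).2 by case: Vw0.
      rewrite /V /=; lra.
    by move: IH; lra.
  + by have := IHB a 1%N a0 isT; rewrite -blockB0.
  + by have := IHB a b.+1 a0 isT; rewrite -blockB.
Qed.

End upper.
End norm_growth.
End shear_action.

(** * Block growth in the 1-, 2- and sup-norm *)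

Section norm_instances.
Context {R : realType}.
Variables alpha beta : R.
Hypothesis alpha_ge1 : 1 <= alpha.
Hypothesis beta_ge1 : 1 <= beta.
Implicit Types (a b : nat) (v : R * R).

Let alpha_ge0 : 0 <= alpha. Proof. exact: le_trans alpha_ge1. Qed.
Let beta_ge0 : 0 <= beta. Proof. exact: le_trans beta_ge1. Qed.

Let natM_ge0 a (x : R) : 0 <= x -> 0 <= a%:R * x.
Proof. by move=> x0; rewrite mulr_ge0. Qed.

Let natM_ge1 a (x : R) : (0 < a)%N -> 1 <= x -> 1 <= a%:R * x.
Proof. by move=> a0 x1; rewrite mulr_ege1// ler1n. Qed.

Let natM_mono a a' (x : R) : 0 <= x -> (a <= a')%N -> a%:R * x <= a'%:R * x.
Proof. by move=> x0 aa; rewrite ler_wpM2r// ler_nat. Qed.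

Let blockE a b v : block alpha beta a b v =
  (v.1 + b%:R * beta * v.2, a%:R * alpha * (v.1 + b%:R * beta * v.2) + v.2).
Proof. by []. Qed.

Let abE a b : a%:R * alpha * b%:R * beta = (a%:R * alpha) * (b%:R * beta).
Proof. by ring. Qed.

Definition norm1 v : R := v.1 + v.2.
Definition norm2 v : R := Num.sqrt (v.1 ^+ 2 + v.2 ^+ 2).
Definition normoo v : R := Num.max v.1 v.2.

Lemma phi1_ge1 a b : 1 <= phi1 alpha beta a b.
Proof.
rewrite /phi1 abE lerDl mulr_ge0//.
  by rewrite divr_ge0// addr_ge0.
by rewrite !addr_ge0// ?mulr_ge0.
Qed.

(** Equality holds on the edge y = alpha x. After clearing the denominator the difference is y -
    alpha x times a factor that is nonnegative because b beta >= 1. *)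
Lemma phi1_block a b v : (0 < a)%N -> (0 < b)%N -> cone alpha v ->
  phi1 alpha beta a b * norm1 v <= norm1 (block alpha beta a b v).
Proof.
case: v => x y a0 b0 [/= x0 xy]; rewrite /phi1 abE blockE /norm1/=.
have p1 := natM_ge1 b0 beta_ge1; have q0 := natM_ge0 a alpha_ge0.
set p := b%:R * beta in p1 *.
have a1 : 0 < 1 + alpha by rewrite ltr_pwDl.
set S := a%:R + _ + _.
have e : (1 + alpha) * (1 + alpha / (1 + alpha) * S) = 1 + alpha + alpha * S.
  by field; rewrite gt_eqF.
rewrite -(ler_pM2l a1) mulrA e /S.
rewrite -subr_ge0 [X in 0 <= X](_ : _ =
  (y - alpha * x) * (p + a%:R * alpha * (p - 1))); last by ring.
by rewrite mulr_ge0// ?subr_ge0// addr_ge0 ?mulr_ge0 ?subr_ge0//; lra.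
Qed.

Lemma psi1_ge1 a b : 1 <= psi1 alpha beta a b.
Proof.
by rewrite /psi1 abE -addrA lerDl addr_ge0// ?mulr_ge0.
Qed.

(** Equality holds on the edge x = 0, and b beta >= 1 gives the sign elsewhere. *)
Lemma psi1_block a b v : (0 < a)%N -> (0 < b)%N -> cone alpha v ->
  norm1 (block alpha beta a b v) <= psi1 alpha beta a b * norm1 v.
Proof.
case: v => x y a0 b0 [/= x0 xy]; rewrite /psi1 abE blockE /norm1/=.
have p1 := natM_ge1 b0 beta_ge1; have q0 := natM_ge0 a alpha_ge0.
set p := b%:R * beta in p1 *; set q := a%:R * alpha in q0 *.
rewrite -subr_ge0 [X in 0 <= X](_ : _ = x * (p + q * (p - 1))); last by ring.
by rewrite mulr_ge0// addr_ge0 ?mulr_ge0 ?subr_ge0//; lra.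
Qed.

Lemma psi1_mono a a' b b' : (a <= a')%N -> (b <= b')%N ->
  psi1 alpha beta a b <= psi1 alpha beta a' b'.
Proof.
move=> aa bb; rewrite /psi1 !abE lerD// ?lerD2l ?natM_mono// ler_pM//.
- exact: natM_ge0.
- exact: natM_ge0.
- exact: natM_mono.
- exact: natM_mono.
Qed.

Lemma phioo_ge1 a b : 1 <= phioo alpha beta a b.
Proof. by rewrite /phioo abE lerDl !mulr_ge0. Qed.

Lemma normoo_cone v : cone alpha v -> normoo v = v.2.
Proof.
move=> [x0 xy]; rewrite /normoo; apply/max_idPr; apply: le_trans xy.
by rewrite ler_peMl.
Qed.

Lemma phioo_block a b v : (0 < a)%N -> (0 < b)%N -> cone alpha v ->
  phioo alpha beta a b * normoo v <= normoo (block alpha beta a b v).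
Proof.
move=> a0 b0 cv; rewrite normoo_cone// le_max; apply/orP; right.
case: v cv => x y [/= x0 xy]; rewrite /phioo abE.
have q0 := natM_ge0 a alpha_ge0.
set p := b%:R * beta; set q := a%:R * alpha in q0 *.
rewrite -subr_ge0 [X in 0 <= X](_ : _ = q * x); last by ring.
exact: mulr_ge0.
Qed.

Lemma psioo_ge1 a b : 1 <= psioo alpha beta a b.
Proof. by rewrite /psioo abE -addrA lerDl addr_ge0// !mulr_ge0. Qed.

(** Since a alpha >= 1, the second coordinate of the image dominates; bounding alpha x by y there is
    sharp on the edge (1, alpha). *)
Lemma psioo_block a b v : (0 < a)%N -> (0 < b)%N -> cone alpha v ->
  normoo (block alpha beta a b v) <= psioo alpha beta a b * normoo v.
Proof.
move=> a0 b0 cv; rewrite (normoo_cone cv).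
case: v cv => x y [/= x0 xy]; rewrite /psioo abE blockE /normoo/=.
have y0 : 0 <= y by rewrite (le_trans _ xy)// mulr_ge0.
have q1 := natM_ge1 a0 alpha_ge1; have p1 := natM_ge1 b0 beta_ge1.
set p := b%:R * beta in p1 *.
have ax : a%:R * (alpha * x) <= a%:R * y by rewrite ler_wpM2l.
have h : a%:R * alpha * (x + p * y) + y <= (1 + a%:R + a%:R * alpha * p) * y.
  by move: ax; lra.
rewrite ge_max h andbT; apply: le_trans h.
have : 1 * (x + p * y) <= a%:R * alpha * (x + p * y).
  by rewrite ler_wpM2r// addr_ge0// mulr_ge0//; lra.
lra.
Qed.

Lemma psioo_mono a a' b b' : (a <= a')%N -> (b <= b')%N ->
  psioo alpha beta a b <= psioo alpha beta a' b'.
Proof.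
move=> aa bb; rewrite /psioo !abE lerD// ?lerD2l ?ler_nat// ler_pM//.
- exact: natM_ge0.
- exact: natM_ge0.
- exact: natM_mono.
- exact: natM_mono.
Qed.

Lemma phi2_ge1 a b : 1 <= phi2 alpha beta a b.
Proof.
have p0 := natM_ge0 b beta_ge0; have q0 := natM_ge0 a alpha_ge0.
rewrite /phi2 abE -mulrA (_ : alpha * b%:R * beta = alpha * (b%:R * beta)); last by ring.
set p := b%:R * beta in p0 *; have pq := mulr_ge0 q0 p0.
have ap := mulr_ge0 alpha_ge0 p0.
rewrite le_min; apply/andP; split; rewrite -[leLHS](sqrtr1 R); apply: ler_wsqrtr.
  have := sqr_ge0 (b%:R : R); have := sqr_ge0 beta; have := sqr_ge0 (a%:R * alpha * p).
  rewrite sqrrD expr1n mul1r => h1 h2 h3; have := mulr_ge0 h3 h2.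
  move: pq h1; rewrite mulr_natl; lra.
rewrite mulrC ler_pdivlMr ?ltr_pwDl ?sqr_ge0// mul1r.
have h1 : 1 <= (1 + alpha * p) ^+ 2 by rewrite expr_ge1// ?lerDl// addr_ge0.
have h2 : 1 <= (1 + a%:R + a%:R * alpha * p) ^+ 2.
  by rewrite expr_ge1// -?addrA ?lerDl// !addr_ge0.
have : alpha ^+ 2 * 1 <= alpha ^+ 2 * (1 + a%:R + a%:R * alpha * p) ^+ 2.
  by rewrite ler_wpM2l// sqr_ge0.
lra.
Qed.

(* With [e = (0, 1)] and [g = (1, alpha)] the edges of the cone and [M] the
   block matrix, [alpha |M e|^2 <= <M e, M g>]; hence the growth is least on
   an edge. *)
Lemma phi2_block a b v : (0 < a)%N -> (0 < b)%N -> cone alpha v ->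
  phi2 alpha beta a b * norm2 v <= norm2 (block alpha beta a b v).
Proof.
case: v => x y a0 b0 [/= x0 xy].
have m0 : 0 <= phi2 alpha beta a b := le_trans ler01 (phi2_ge1 a b).
have p0 := natM_ge0 b beta_ge0; have q0 := natM_ge0 a alpha_ge0.
set m := phi2 _ _ _ _ in m0 *.
rewrite /norm2 -{1}(ger0_norm m0) -sqrtr_sqr -sqrtrM ?sqr_ge0// ler_wsqrtr//.
set p := b%:R * beta in p0 *; set q := a%:R * alpha in q0 *.
have hP : m ^+ 2 <= (1 + q * p) ^+ 2 + p ^+ 2.
  rewrite -[leRHS]sqr_sqrtr ?addr_ge0 ?sqr_ge0// lerXn2r ?nnegrE ?sqrtr_ge0//.
  by rewrite /m /phi2 abE -exprMn ge_min lexx.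
have hQ : m ^+ 2 * (1 + alpha ^+ 2) <=
    (alpha + q * (1 + alpha * p)) ^+ 2 + (1 + alpha * p) ^+ 2.
  have a1 : 0 < 1 + alpha ^+ 2 by rewrite ltr_pwDl ?sqr_ge0.
  rewrite -ler_pdivlMr// mulrC.
  rewrite -[leRHS]sqr_sqrtr; last first.
    by rewrite mulr_ge0 ?addr_ge0 ?sqr_ge0 ?invr_ge0 ?ltW.
  rewrite lerXn2r ?nnegrE ?sqrtr_ge0// /m /phi2 ge_min; apply/orP; right.
  rewrite (_ : alpha * b%:R * beta = alpha * p); last by rewrite /p; ring.
  rewrite -exprMn (_ : alpha * (1 + _ + _) = alpha + q * (1 + alpha * p))//.
  by rewrite /q /p; ring.
move: (m ^+ 2) hP hQ => M hP hQ.
(* The vector is s (0, 1) + x (1, alpha) with s, x >= 0; both squared norms are quadratic forms in s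
   and x, compared coefficient by coefficient. *)
pose s := y - alpha * x; have s0 : 0 <= s by rewrite subr_ge0.
have -> : y = s + alpha * x by rewrite /s subrK.
have hPa : alpha * M <= p * (1 + alpha * p) +
    (1 + q * p) * (alpha + q * (1 + alpha * p)).
  apply: (@le_trans _ _ (alpha * ((1 + q * p) ^+ 2 + p ^+ 2))).
    by rewrite ler_wpM2l.
  rewrite -subr_ge0 [X in 0 <= X](_ : _ = p + (1 + q * p) * q); last by ring.
  by rewrite addr_ge0// mulr_ge0// addr_ge0// mulr_ge0.
have h1 : s ^+ 2 * M <= s ^+ 2 * ((1 + q * p) ^+ 2 + p ^+ 2).
  by rewrite ler_wpM2l// sqr_ge0.
have h2 := ler_wpM2l (sqr_ge0 x) hQ.
have h3 := ler_wpM2l (mulr_ge0 s0 x0) hPa.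
by move: h1 h2 h3; rewrite /= -/p -/q; clearbody s p q; lra.
Qed.

Let Cab_ge0 a b : 0 <= Cab alpha beta a b.
Proof. by rewrite /Cab addr_ge0 ?sqr_ge0. Qed.

Let psi2_arg_ge1 a b : 1 <= 2^-1 * (2 + Cab alpha beta a b +
  Num.sqrt (Cab alpha beta a b * (Cab alpha beta a b + 4))).
Proof.
have := Cab_ge0 a b.
have := sqrtr_ge0 (Cab alpha beta a b * (Cab alpha beta a b + 4)); lra.
Qed.

Lemma psi2_ge1 a b : 1 <= psi2 alpha beta a b.
Proof.
by rewrite /psi2 -{1}(sqrtr1 R) ler_wsqrtr.
Qed.

(* [psi2 ^+ 2] is the larger eigenvalue of the Gram matrix of the block; with
   [A, D >= 0] and [A D = B ^+ 2], [(A + D) (A x^2 - 2 B x y + D y^2)] is a sum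
   of two squares. *)
Lemma psi2_block a b v : (0 < a)%N -> (0 < b)%N -> cone alpha v ->
  norm2 (block alpha beta a b v) <= psi2 alpha beta a b * norm2 v.
Proof.
case: v => x y a0 b0 _; rewrite /norm2 /psi2 -sqrtrM ?(le_trans ler01)//.
have p1 := natM_ge1 b0 beta_ge1.
have := Cab_ge0 a b.
rewrite /Cab abE /=; set p := b%:R * beta in p1 *; set q := a%:R * alpha.
set C := _ + _ => C0; set r := Num.sqrt (C * _).
have r2 : r ^+ 2 = C * (C + 4) by rewrite sqr_sqrtr// mulr_ge0// addr_ge0.
have CE : C = (q + p) ^+ 2 + (q * p) ^+ 2 by [].
have q0 : 0 <= q by exact: natM_ge0.
have C_gt0 : 0 < C.
  by rewrite CE ltr_pwDl ?sqr_ge0// exprn_gt0// ltr_wpDl//; lra.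
have r0 : 0 < r by rewrite sqrtr_gt0 mulr_gt0// addr_gt0.
apply: ler_wsqrtr.
pose S := 2^-1 * (2 + C + r).
(* Characteristic equation of the Gram matrix, which has trace 2 + C and determinant 1. *)
have S2 : S ^+ 2 = (2 + C) * S - 1.
  have -> : S ^+ 2 = 4^-1 * ((2 + C) ^+ 2 + 2 * (2 + C) * r + r ^+ 2).
    by rewrite /S; field.
  by rewrite r2 /S; field.
(* The diagonal of S I minus the Gram matrix; B below is the off-diagonal entry of the Gram matrix,
   so A D = B^2 says that S is an eigenvalue. *)
pose A := S - (1 + q ^+ 2); pose D := S - (p ^+ 2 + (1 + q * p) ^+ 2).
pose B := p + q * (1 + q * p).
have AD : A + D = r by rewrite /A /D /S CE; field.
have AB : A * D = B ^+ 2.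
  have -> : A * D = S ^+ 2 - (2 + C) * S +
      (1 + q ^+ 2) * (p ^+ 2 + (1 + q * p) ^+ 2) by rewrite /A /D CE; ring.
  by rewrite S2 /B; ring.
rewrite -subr_ge0 -(pmulr_rge0 _ r0) -/S.
suff -> : r * (S * (x ^+ 2 + y ^+ 2) - ((x + p * y) ^+ 2 +
    (q * (x + p * y) + y) ^+ 2)) = (A * x - B * y) ^+ 2 + (D * y - B * x) ^+ 2.
  by rewrite addr_ge0 ?sqr_ge0.
have -> : (A * x - B * y) ^+ 2 + (D * y - B * x) ^+ 2 =
    A ^+ 2 * x ^+ 2 + D ^+ 2 * y ^+ 2 - 2 * (A + D) * B * x * y +
    B ^+ 2 * (x ^+ 2 + y ^+ 2) by ring.
by rewrite -AB -AD /A /D /B; ring.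
Qed.

Lemma psi2_mono a a' b b' : (a <= a')%N -> (b <= b')%N ->
  psi2 alpha beta a b <= psi2 alpha beta a' b'.
Proof.
move=> aa bb; rewrite /psi2 ler_wsqrtr//.
have C0 := Cab_ge0 a b; have C0' := Cab_ge0 a' b'.
have CC : Cab alpha beta a b <= Cab alpha beta a' b'.
  rewrite /Cab !abE lerD// lerXn2r ?nnegrE ?addr_ge0 ?mulr_ge0//.
    by rewrite lerD// natM_mono.
  by rewrite ler_pM ?mulr_ge0 ?natM_mono.
rewrite ler_pM2l// lerD// ?lerD2l// ler_wsqrtr// ler_pM//.
  exact: addr_ge0.
by rewrite lerD2r.
Qed.

End norm_instances.

(** * Expectations over fair coins as word averages *)

Section coin_words.
Context d (T : measurableType d) (R : realType) (P : probability T R).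
Variable X : nat -> {RV P >-> bool}.
Hypothesis HX : iid_fair_coins X.

Let toss N w : seq bool := mkseq (X^~ w) N.

Let coin_event N (t : seq bool) : set T :=
  \bigcap_(j in [set` iota 0 N]) X j @^-1` [set nth false t j].

Let coin_eventP N t w : size t = N -> coin_event N t w <-> toss N w = t.
Proof.
move=> tN; split => [h|<- j]; last first.
  by rewrite /= mem_iota add0n => /andP[_ jN]; rewrite nth_mkseq.
apply: (@eq_from_nth _ false); rewrite size_mkseq// => i iN.
by rewrite nth_mkseq//; apply: h; rewrite /= mem_iota add0n.
Qed.

Let measurable_coin_event N t : measurable (coin_event N t).
Proof.
apply: fin_bigcap_measurable; first exact: finite_seq.
by move=> j _; rewrite -[_ @^-1` _]setTI; exact: measurable_funP.
Qed.

Let coin_event_prob N t : P (coin_event N t) = (2^-1 ^+ N)%:E.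
Proof.
rewrite /coin_event (HX.1 (iota 0 N) (fun j => [set nth false t j]))//; last first.
  exact: iota_uniq.
under eq_bigr do rewrite HX.2.
by rewrite prodEFin big_const_seq count_predT size_iota iter_mulr_1.
Qed.

(** The integrand is a finite combination of indicators of cylinder events, each of probability 2^-N
    by independence. *)
Lemma expectation_coins (F : seq bool -> R) N :
  'E_P[fun w => F (mkseq (X^~ w) N)]%E = (avg N F)%:E.
Proof.
rewrite unlock avg_words.
have -> : (fun w => (F (mkseq (X^~ w) N))%:E) =
    (fun w => \sum_(t <- words N) ((F t)%:E * (\1_(coin_event N t) w)%:E)%E)%E.
  apply/funext => w; have sw : size (toss N w) = N by rewrite size_mkseq.
  have tw : toss N w \in words N by rewrite mem_words sw.
  rewrite (bigD1_seq _ tw (uniq_words N))/= indicE mem_set ?mule1; last first.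
    exact/coin_eventP.
  rewrite big_seq_cond big1 ?adde0// => t /andP[tN tw'].
  rewrite indicE memNset ?mule0//.
  move: tN; rewrite mem_words => /eqP tN /(coin_eventP _ tN) e.
  by rewrite e eqxx in tw'.
have intI t : P.-integrable setT (fun w => (\1_(coin_event N t) w)%:E).
  by apply: integrable_indic => //; rewrite ltey_eq fin_num_measure.
rewrite integral_sum//; last by move=> t; apply: integrableZl.
rewrite -sumEFin; apply: eq_bigr => t _.
rewrite integralZl// integral_indic// setIT mulrC EFinM; congr (_ * _)%E.
exact: coin_event_prob.
Qed.

End coin_words.

(** * Equivalence of norms on 2 x 2 matrices *)

Section matrix_norm_equivalence.
Context {R : realType}.
Variable nrm : 'M[R]_2 -> R.
Hypothesis Hnrm : matrix_norm nrm.

Definition entry_sum (M : 'M[R]_2) : R := \sum_i \sum_j `|M i j|.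

Let nrmZ (c : R) M : nrm (c *: M) = `|c| * nrm M. Proof. by case: Hnrm. Qed.
Let nrmD M N : nrm (M + N) <= nrm M + nrm N. Proof. by case: Hnrm. Qed.

Let nrm0 : nrm 0 = 0.
Proof. by rewrite -(scale0r 0) nrmZ normr0 mul0r. Qed.

Let nrmN M : nrm (- M) = nrm M.
Proof. by rewrite -scaleN1r nrmZ normrN normr1 mul1r. Qed.

Let nrm_ge0 M : 0 <= nrm M.
Proof. by have := nrmD M (- M); rewrite subrr nrm0 nrmN; lra. Qed.

Let nrm_gt0 M : M != 0 -> 0 < nrm M.
Proof.
move=> M0; rewrite lt_def nrm_ge0 andbT; apply: contraNneq M0 => h.
by apply/eqP; case: Hnrm => + _ _; apply.
Qed.

Let nrm_sum (I : Type) (r : seq I) (F : I -> 'M[R]_2) :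
  nrm (\sum_(i <- r) F i) <= \sum_(i <- r) nrm (F i).
Proof.
elim: r => [|i r IH]; first by rewrite !big_nil nrm0.
by rewrite !big_cons (le_trans (nrmD _ _))// lerD2l.
Qed.

Let entry_sum_ge0 M : 0 <= entry_sum M.
Proof. by rewrite /entry_sum sumr_ge0// => i _; rewrite sumr_ge0. Qed.

Let le_entry_sum (M : 'M[R]_2) i j : `|M i j| <= entry_sum M.
Proof.
rewrite /entry_sum (bigD1 i)//= (bigD1 j)//= -addrA lerDl addr_ge0// sumr_ge0//.
by move=> k _; rewrite sumr_ge0.
Qed.

Lemma norm_le_entry_sum : exists2 C, 0 < C & forall M, nrm M <= C * entry_sum M.
Proof.
exists (1 + \sum_i \sum_j nrm (delta_mx i j)).
  by rewrite ltr_pwDl// sumr_ge0// => i _; rewrite sumr_ge0.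
move=> M; rewrite {1}[M]matrix_sum_delta (le_trans (nrm_sum _ _))//.
rewrite mulrDl mul1r ler_wpDl// mulr_suml ler_sum// => i _.
rewrite (le_trans (nrm_sum _ _))// mulr_suml ler_sum// => j _.
by rewrite nrmZ mulrC ler_wpM2l.
Qed.

(** Matrices are flattened to row vectors, where [nrm] is Lipschitz by the opposite inequality. It
    attains a minimum on the compact unit sphere, positive by definiteness, and homogeneity extends
    the bound; 4 is the number of entries. *)
Lemma entry_sum_le_norm : exists2 c, 0 < c & forall M, c * entry_sum M <= nrm M.
Proof.
have [C C0 nrmC] := norm_le_entry_sum.
pose g (v : 'rV[R]_(2 * 2)) : R := nrm (vec_mx v).
have entry_le (v : 'rV[R]_(2 * 2)) k : `|v ord0 k| <= `|v|.
  rewrite [leRHS]/Num.norm/= mx_normrE; apply/bigmax_geP; right => /=.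
  by exists (ord0, k).
have sum_le (M : 'M[R]_2) : entry_sum M <= 4 * `|mxvec M|.
  have h i j : `|M i j| <= `|mxvec M| by rewrite -mxvecE; exact: entry_le.
  rewrite /entry_sum (le_trans (ler_sum _ (fun i _ => ler_sum _ (fun j _ => h i j))))//.
  by rewrite !big_const_ord/=; lra.
have gD v w : `|g v - g w| <= C * (4 * `|v - w|).
  have gw : g (v - w) <= C * (4 * `|v - w|).
    apply: (le_trans (nrmC _)); rewrite ler_pM2l//.
    by have := sum_le (vec_mx (v - w)); rewrite vec_mxK.
  have h1 : g v <= g (v - w) + g w by rewrite /g -{1}(subrK w v) linearD/=.
  have h2 : g w <= g (v - w) + g v.
    rewrite /g -[X in X + _]nrmN -linearN/= -{1}(subrK v w) opprB linearD/=.
    exact: nrmD.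
  by rewrite ler_norml; apply/andP; split; lra.
pose K := [set v : 'rV[R]_(2 * 2) | `|v| = 1].
have gc : continuous g.
  move=> v; apply/(@cvgrPdist_le _ _ _ (nbhs v) (nbhs_filter v)) => e e0.
  near=> w.
  apply: (le_trans (gD v w)).
  have h : `|v - w| <= e / (C * 4).
    near: w; have ec : 0 < e / (C * 4) by rewrite divr_gt0// mulr_gt0.
    apply: filterS (nbhsx_ballx v _ ec) => y.
    by rewrite -ball_normE/= => /ltW.
  by move: h; rewrite ler_pdivlMr ?mulr_gt0//; lra.
have Kcpt : compact K.
  apply: bounded_closed_compact.
    exists 1; split => // t t1 v /= ->; exact: ltW.
  rewrite (_ : K = Num.norm @^-1` [set 1])//.
  apply: closed_comp => //; first by move=> v _; exact: norm_continuous.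
pose v1 : 'rV[R]_(2 * 2) := const_mx 1.
have v1_neq0 : v1 != 0.
  by apply/eqP => /matrixP/(_ ord0 ord0); rewrite !mxE => /eqP; rewrite oner_eq0.
have K0 : K !=set0.
  exists (`|v1|^-1 *: v1); rewrite /K/= normrZ normfV normr_id mulVf//.
  by rewrite normr_eq0.
have [v0 v0K vmin] := compact_EVT_min K0 Kcpt (continuous_subspaceT gc).
rewrite inE in v0K.
have m0 : 0 < g v0.
  apply: nrm_gt0; apply/eqP => h.
  have := v0K; rewrite /K/= -[v0]vec_mxK h linear0 normr0 => /eqP.
  by rewrite eq_sym oner_eq0.
exists (g v0 / 4) => [|M]; first by rewrite divr_gt0.
have [->|M0] := eqVneq M 0.
  by rewrite nrm0 /entry_sum big1 ?mulr0// => i _; rewrite big1// => j _; rewrite mxE normr0.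
have vM0 : 0 < `|mxvec M| by rewrite normr_gt0 mxvec_eq0.
have := vmin (`|mxvec M|^-1 *: mxvec M).
have -> : `|mxvec M|^-1 *: mxvec M \in K.
  by rewrite inE /K/= normrZ normfV normr_id mulVf// gt_eqF.
rewrite {2}/g linearZ/= mxvecK nrmZ normfV normr_id => /(_ isT).
rewrite mulrC ler_pdivlMr// => h.
have := ler_wpM2l (ltW m0) (sum_le M); lra.
Unshelve. all: by end_near. Qed.

End matrix_norm_equivalence.

(** * Existence of the exponent and comparison with the series *)

Section lyapunov_limit.
Context {R : realType}.
Variables alpha beta : R.
Hypothesis alpha_ge1 : 1 <= alpha.
Hypothesis beta_ge1 : 1 <= beta.

Let alpha_ge0 : 0 <= alpha. Proof. exact: le_trans alpha_ge1. Qed.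
Let beta_ge0 : 0 <= beta. Proof. exact: le_trans beta_ge1. Qed.

Definition shear (c : bool) : 'M[R]_2 := if c then shearA alpha else shearB beta.

Definition word_product (w : seq bool) : 'M[R]_2 := \prod_(c <- w) shear c.

Let act11 w := act alpha beta w (1, 1).

(** The row sums are the image of (1, 1). As the entries are nonnegative, the matrix norm
    [entry_sum] is read off the orbit of this one vector. *)
Lemma word_product_act w :
  [/\ forall i j, 0 <= word_product w i j,
      word_product w ord0 ord0 + word_product w ord0 ord_max = (act11 w).1 &
      word_product w ord_max ord0 + word_product w ord_max ord_max = (act11 w).2].
Proof.
rewrite /word_product /act11.
elim: w => [|c w [IH0 IH1 IH2]].
  by rewrite big_nil; split => [i j||]; rewrite !mxE//= ?ler0n ?addr0 ?add0r.
rewrite big_cons; set M := \prod_(_ <- _) _ in IH0 IH1 IH2 *.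
have E i j : (shear c * M) i j = shear c i ord0 * M ord0 j + shear c i ord_max * M ord_max j.
  rewrite mxE big_ord_recl big_ord1; congr (_ + _ * M _ _); try congr (shear c _ _);
  exact: val_inj.
split=> [i j||].
- rewrite E addr_ge0// mulr_ge0//; rewrite /shear; case: c {E}; rewrite mxE.
  + by case: ifP => // _; case: ifP.
  + by case: ifP => // _; case: ifP.
  + by case: ifP => // _; case: ifP.
  + by case: ifP => // _; case: ifP.
- by rewrite !E /shear; clearbody M; case: c {E} => /=; rewrite !mxE/= -?IH1 -?IH2; ring.
- by rewrite !E /shear; clearbody M; case: c {E} => /=; rewrite !mxE/= -?IH1 -?IH2; ring.
Qed.

Definition word_norm (w : seq bool) : R := (act11 w).1 + (act11 w).2.

Lemma entry_sum_word_product w : entry_sum (word_product w) = word_norm w.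
Proof.
rewrite /word_norm; have [M0 <- <-] := word_product_act w.
rewrite /entry_sum !big_ord_recl !big_ord0 !addr0.
have -> : lift ord0 ord0 = ord_max :> 'I_2 by exact: val_inj.
by rewrite !ger0_norm.
Qed.

Lemma word_norm_ge2 w : 2 <= word_norm w.
Proof. by case: (act_ge1 alpha_ge1 beta_ge1 w); rewrite /word_norm /act11/=; lra. Qed.

Let word_norm_gt0 w : 0 < word_norm w.
Proof. exact: lt_le_trans (word_norm_ge2 w). Qed.

Lemma act_scale w (c : R) v :
  act alpha beta w (c * v.1, c * v.2) =
  (c * (act alpha beta w v).1, c * (act alpha beta w v).2).
Proof.
elim: w => [//|[] w /= ->]; rewrite /step/=; congr pair; ring.
Qed.

(** The image of (1, 1) under v lies below [word_norm v] times (1, 1), and u acts monotonically and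
    homogeneously. *)
Lemma word_norm_cat u v : word_norm (u ++ v) <= word_norm u * word_norm v.
Proof.
rewrite {1}/word_norm /act11 /act foldr_cat -/(act _ _ v _) -/(act _ _ u _).
rewrite -/(act11 v).
have v0 := act_ge0 alpha_ge1 beta_ge1 v; rewrite -/(act11 v) in v0.
have vle : le2 (act11 v) (word_norm v * 1, word_norm v * 1).
  by case: v0 => /= ? ?; split; rewrite /= mulr1 /word_norm ?lerDl ?lerDr.
have [] := le2_act alpha_ge1 beta_ge1 u vle.
have := act_scale u (word_norm v) (1, 1); rewrite /= => ->.
move=> h1 h2; apply: le_trans (lerD h1 h2) _.
by rewrite -mulrDr mulrC.
Qed.

Lemma word_norm_limit :
  cvgn (fun n => n%:R^-1 * avg n (fun w => ln (word_norm w))).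
Proof.
apply: fekete => [n|m n].
  by apply: avg_ge0 => w; apply: ln_ge0; have := word_norm_ge2 w; lra.
rewrite avg_cat -[X in _ <= _ + X](avg_cst m) -avgD; apply: ler_avg => u.
rewrite -[X in _ <= X + _](avg_cst n) -avgD; apply: ler_avg => v.
by rewrite -lnM ?posrE// ler_ln ?posrE ?mulr_gt0 ?word_norm_cat.
Qed.

Section bounds.
Variable nrm : 'M[R]_2 -> R.
Hypothesis Hnrm : matrix_norm nrm.

Let lnnrm w := ln (nrm (word_product w)).

(** The error K does not depend on the length of the word, so it vanishes after division by N and
    the exponent is the same for every norm. *)
Lemma ln_norm_word_norm : exists K, forall w,
  ln (word_norm w) - K <= lnnrm w <= ln (word_norm w) + K.
Proof.
have [C C0 hC] := norm_le_entry_sum Hnrm; have [c c0 hc] := entry_sum_le_norm Hnrm.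
exists (`|ln C| + `|ln c|) => w.
have := hC (word_product w); have := hc (word_product w).
rewrite entry_sum_word_product => h1 h2.
have n0 : 0 < nrm (word_product w) by apply: lt_le_trans h1; rewrite mulr_gt0.
have : ln (c * word_norm w) <= lnnrm w by rewrite ler_ln ?posrE ?mulr_gt0.
have : lnnrm w <= ln (C * word_norm w) by rewrite ler_ln ?posrE ?mulr_gt0.
rewrite !lnM ?posrE//.
have := ler_norm (ln C); have := ler_norm (- ln c); rewrite normrN.
have := normr_ge0 (ln C); have := normr_ge0 (ln c).
by move=> *; apply/andP; split; lra.
Qed.

Lemma ln_norm_limit : exists l : R, n%:R^-1 * avg n lnnrm @[n --> \oo] --> l.
Proof.
have [K hK] := ln_norm_word_norm.
have /cvg_ex[l hl] := word_norm_limit; exists l.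
apply: squeeze_cvgr (cvg_shift_mean (- K) hl) (cvg_shift_mean K hl).
apply: nearW => n; rewrite !ler_wpM2l ?invr_ge0//=.
  by rewrite -[X in _ <= _ + X](avg_cst n) -avgD; apply: ler_avg => w; case/andP: (hK w).
by rewrite -[X in _ + X <= _](avg_cst n) -avgD; apply: ler_avg => w; case/andP: (hK w).
Qed.

Variable Nm : R * R -> R.
Hypothesis Nm_mono : forall u v, le2 (0, 0) u -> le2 u v -> Nm u <= Nm v.
Hypothesis Nm_le : forall v, le2 (0, 0) v -> Nm v <= v.1 + v.2.
Hypothesis Nm_ge : forall v, le2 (0, 0) v -> v.1 + v.2 <= 2 * Nm v.

Let act0 w := act_ge0 alpha_ge1 beta_ge1 w.

Let ln_Nm_le w : ln (Nm (act11 w)) <= ln (word_norm w).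
Proof.
have := Nm_ge (act0 w); have := word_norm_ge2 w; rewrite /word_norm /act11 => h1 h2.
rewrite ler_ln ?posrE; [exact: Nm_le|lra|lra].
Qed.

Let ln_Nm_ge w : ln (word_norm w) <= ln 2 + ln (Nm (act11 w)).
Proof.
have := Nm_ge (act0 w); have := word_norm_ge2 w; rewrite /word_norm /act11 => h1 h2.
rewrite -lnM ?posrE//; last by lra.
by rewrite ler_ln ?posrE//; lra.
Qed.

Lemma block_sum_le (phi : nat -> nat -> R) (l : R) :
  (forall a b, 1 <= phi a b) ->
  (forall a b v, (0 < a)%N -> (0 < b)%N -> cone alpha v ->
    phi a b * Nm v <= Nm (block alpha beta a b v)) ->
  n%:R^-1 * avg n lnnrm @[n --> \oo] --> l ->
  (geometric_log_sum phi <= 4%:E * l%:E)%E.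
Proof.
move=> phi1 phiB hl; have [K hK] := ln_norm_word_norm.
have f0 a b : 0 <= ln (phi a b) by rewrite ln_ge0.
apply: (@mean_ge_block_sum _ _ f0 _ _ (K + ln (4 * beta)) _ _ hl) => // N.
rewrite -[X in _ <= _ + X](avg_cst N) -avgD; apply: ler_avg => w.
have := growth_ge alpha_ge1 beta_ge1 Nm_mono Nm_le Nm_ge phi1 phiB w.
have := head_block_ge0 (fun a b _ _ => f0 a b) w.
have /andP[+ _] := hK w; have := ln_Nm_le w; rewrite /act11; lra.
Qed.

Lemma block_sum_ge (psi : nat -> nat -> R) (l : R) :
  (forall a b, 1 <= psi a b) ->
  (forall a b v, (0 < a)%N -> (0 < b)%N -> cone alpha v ->
    Nm (block alpha beta a b v) <= psi a b * Nm v) ->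
  (forall a a' b b', (a <= a')%N -> (b <= b')%N -> psi a b <= psi a' b') ->
  n%:R^-1 * avg n lnnrm @[n --> \oo] --> l ->
  (4%:E * l%:E <= geometric_log_sum psi)%E.
Proof.
move=> psi1 psiB psi_mono hl; have [K hK] := ln_norm_word_norm.
have psi0 a b : 0 < psi a b by exact: lt_le_trans (psi1 a b).
have f0 a b : 0 <= ln (psi a b) by rewrite ln_ge0.
have fm a a' b b' : (a <= a')%N -> (b <= b')%N -> ln (psi a b) <= ln (psi a' b').
  by move=> aa bb; rewrite ler_ln ?posrE// psi_mono.
set c := ln (2 * (1 + beta)); set D := ln (Nm (1, alpha)).
apply: (@mean_le_block_sum _ _ f0 _ _ _ _ (c + (D + K + ln 2)) _ _ hl) => //.
- by move=> a a' b aa; exact: fm.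
- by move=> a b b' bb; exact: fm.
move=> N.
have c0 : 0 <= c by rewrite ln_ge0//; have := beta_ge0; lra.
apply: (@le_trans _ _ (avg N (fun w => gain (fun a b => ln (psi a b)) w +
  head_block (fun a b => ln (psi a b)) w + c * leading_B w + (D + K + ln 2)))).
  apply: ler_avg => w.
  have := growth_le alpha_ge1 beta_ge1 Nm_mono Nm_le Nm_ge psi1 psiB w.
  have /andP[_] := hK w; have := ln_Nm_ge w; rewrite /act11 -/c -/D; lra.
rewrite !avgD avgZ !avg_cst; have := ler_wpM2l c0 (@avg_leading_B R N); lra.
Qed.

End bounds.
End lyapunov_limit.

(** * The exponent as a limit of word averages *)

Lemma lyapunov_exponentE (R : realType) (d : measure_display)
    (T : measurableType d) (P : probability T R) (X : nat -> {RV P >-> bool})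
    (HX : iid_fair_coins X) (nrm : 'M[R]_2 -> R) (alpha beta l : R) :
  n%:R^-1 * avg n (fun w => ln (nrm (word_product alpha beta w))) @[n --> \oo]
    --> l ->
  lyapunov_exponent X nrm alpha beta = l%:E.
Proof.
move=> hl; rewrite /lyapunov_exponent; apply: cvg_lim => //.
rewrite (_ : (fun N : nat => _) = EFin \o
  (fun n => n%:R^-1 * avg n (fun w => ln (nrm (word_product alpha beta w))))).
  exact: cvg_comp hl _.
apply/funext => N /=; rewrite EFinM -(expectation_coins HX); congr (_ * _)%E.
congr expectation; apply/funext => w; congr (ln (nrm _)).
by rewrite /random_product /word_product /mkseq big_map -[N in iota 0 N]subn0 big_mkord.
Qed.

(** * Monotonicity of the three norms and comparison with x + y *)

Section norm_comparisons.
Context {R : realType}.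
Implicit Types u v : R * R.

Lemma norm1_mono u v : le2 (0, 0) u -> le2 u v -> norm1 u <= norm1 v.
Proof. by move=> _ [? ?]; rewrite lerD. Qed.

Lemma norm1_le v : le2 (0, 0) v -> norm1 v <= v.1 + v.2.
Proof. by []. Qed.

Lemma norm1_ge v : le2 (0, 0) v -> v.1 + v.2 <= 2 * norm1 v.
Proof. by move=> [/= v1 v2]; rewrite /norm1; lra. Qed.

Lemma norm2_mono u v : le2 (0, 0) u -> le2 u v -> norm2 u <= norm2 v.
Proof.
move=> [/= u1 u2] [uv1 uv2]; rewrite ler_wsqrtr// lerD// lerXn2r// nnegrE.
  exact: le_trans uv1.
exact: le_trans uv2.
Qed.

Lemma norm2_le v : le2 (0, 0) v -> norm2 v <= v.1 + v.2.
Proof.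
move=> [/= v1 v2]; rewrite -[leRHS]ger0_norm ?addr_ge0// -sqrtr_sqr ler_wsqrtr//.
by have := mulr_ge0 v1 v2; lra.
Qed.

Lemma norm2_ge v : le2 (0, 0) v -> v.1 + v.2 <= 2 * norm2 v.
Proof.
move=> [/= v1 v2].
have h (x y : R) : 0 <= x -> x <= Num.sqrt (x ^+ 2 + y ^+ 2).
  move=> x0; rewrite -{1}(ger0_norm x0) -sqrtr_sqr ler_wsqrtr// lerDl.
  exact: sqr_ge0.
have := h _ v.2 v1; have := h _ v.1 v2; rewrite addrC -/(norm2 v); lra.
Qed.

Lemma normoo_mono u v : le2 (0, 0) u -> le2 u v -> normoo u <= normoo v.
Proof.
by move=> _ [uv1 uv2]; rewrite /normoo ge_max !le_max uv1 uv2 orbT.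
Qed.

Lemma normoo_le v : le2 (0, 0) v -> normoo v <= v.1 + v.2.
Proof. by move=> [/= v1 v2]; rewrite /normoo ge_max lerDl lerDr v1 v2. Qed.

Lemma normoo_ge v : le2 (0, 0) v -> v.1 + v.2 <= 2 * normoo v.
Proof. by move=> _; rewrite mulr_natl mulr2n lerD// le_max lexx ?orbT. Qed.

End norm_comparisons.

Local Open Scope ereal_scope.

Theorem theorem1 (R : realType) (d : measure_display) (T : measurableType d)
    (P : probability T R) (X : nat -> {RV P >-> bool})
    (HX : iid_fair_coins X)
    (nrm : 'M[R]_2 -> R) (Hnrm : matrix_norm nrm)
    (alpha beta : R) (Halpha : (1 <= alpha)%R) (Hbeta : (1 <= beta)%R) :
  let L f := geometric_log_sum (f alpha beta) in
  let lambda := lyapunov_exponent X nrm alpha beta in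
  maxe (L phi1) (maxe (L phi2) (L phioo)) <= 4%:E * lambda /\
  4%:E * lambda <= mine (L psi1) (mine (L psi2) (L psioo)).
Proof.
move=> L lambda.
have [l hl] := ln_norm_limit Halpha Hbeta Hnrm.
have -> : lambda = l%:E by exact: lyapunov_exponentE.
rewrite /L !ge_max !le_min; split; apply/and3P; split.
- apply: (block_sum_le Halpha Hbeta Hnrm (@norm1_mono R) (@norm1_le R) (@norm1_ge R)) hl.
  + exact: phi1_ge1.
  + exact: phi1_block.
- apply: (block_sum_le Halpha Hbeta Hnrm (@norm2_mono R) (@norm2_le R) (@norm2_ge R)) hl.
  + exact: phi2_ge1.
  + exact: phi2_block.
- apply: (block_sum_le Halpha Hbeta Hnrm (@normoo_mono R) (@normoo_le R) (@normoo_ge R)) hl.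
  + exact: phioo_ge1.
  + exact: phioo_block.
- apply: (block_sum_ge Halpha Hbeta Hnrm (@norm1_mono R) (@norm1_le R) (@norm1_ge R)) hl.
  + exact: psi1_ge1.
  + exact: psi1_block.
  + exact: psi1_mono.
- apply: (block_sum_ge Halpha Hbeta Hnrm (@norm2_mono R) (@norm2_le R) (@norm2_ge R)) hl.
  + exact: psi2_ge1.
  + exact: psi2_block.
  + exact: psi2_mono.
- apply: (block_sum_ge Halpha Hbeta Hnrm (@normoo_mono R) (@normoo_le R) (@normoo_ge R)) hl.
  + exact: psioo_ge1.
  + exact: psioo_block.
  + exact: psioo_mono.
Qed.
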